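(* Let $h \ge 1$, $n \ge 1$ and $a \ge 1$ be integers, and let $x$ be a label different from $1,2,\ldots,h$. Let the deck $D$ be a permutation of the multiset $\{1, 2, \ldots, h, x^n\}$. Let $r$ be the number of cards labeled $c$, $1 \le c \le h$, that are not preceded by a card labeled $c-1$ in $D$. Let $l$ be the number of cards labeled $x$ that precede the card labeled $h$ in $D$. Then the probability that an $a$-shuffle applied to the sorted deck $1, 2, \ldots, h, x^n$ results in $D$ is $$\frac{1}{a^{n+h}} \sum_{m=r-1}^{a-1} \binom{m-r+h}{h-1} (a-m-1)^l (a-m)^{n-l},$$ where if $l = 0$ and $m = a-1$, $(a-m-1)^l$ must be taken to be $1$.
   Context: A deck of $N$ cards is a finite sequence of $N$ labels, listed from top to bottom; labels may repeat, and cards with the same label are indistinguishable. The notation $x^n$ means $n$ cards labeled $x$ (consecutive, when it occurs in a deck). A card precedes another in $D$ if it occupies an earlier (not necessarily adjacent) position in $D$. In particular, since no card is labeled $0$, the card labeled $1$ is always counted in $r$. A sum whose lower limit exceeds its upper limit is $0$. A shuffle of $N$ cards is a permutation $\pi \in S_N$; $\pi(i)=j$ means that the card in position $i$ is sent to position $j$, so $\pi$ applied to the deck $c_1,\ldots,c_N$ results in the deck $c_{\pi^{-1}(1)},\ldots,c_{\pi^{-1}(N)}$. The $a$-shuffle is the following probability distribution on $S_N$. Choose a sequence $(a_1,\ldots,a_N)$ uniformly from the $a^N$ integer sequences with $0 \le a_i < a$. Sort it stably: let $i_1,\ldots,i_N$ be the unique permutation of $\{1,\ldots,N\}$ with $a_{i_1}\le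 a_{i_2}\le\cdots\le a_{i_N}$ and $i_j<i_{j+1}$ whenever $a_{i_j}=a_{i_{j+1}}$. The resulting shuffle is $\pi$ with $\pi(k)=i_k$ for $1\le k\le N$. *)

(* Defs.v *)
From mathcomp Require Import all_boot all_order all_algebra all_fingroup.

Set Implicit Arguments.
Unset Strict Implicit.
Unset Printing Implicit Defensive.

Import GRing.Theory Num.Theory.

Local Open Scope nat_scope.

(* A label is a number [inl c] or any other symbol [inr t], so that the label x
   need not be a number. *)
Definition label (T : eqType) : eqType := (nat + T)%type.

(* Positions are numbered from 0 (the top card) to N - 1. *)
Definition deck (T : eqType) (N : nat) := N.-tuple (label T).

Definition sorted_deck (T : eqType) (h n : nat) (x : label T) : deck T (h + n) :=
  [tuple of [seq (inl c : label T) | c <- iota 1 h] ++ nseq n x].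

(* [p i] is the position to which the card in position [i] is sent. *)
Definition apply_shuffle (T : eqType) (N : nat) (p : 'S_N) (D : deck T N) :
    deck T N :=
  [tuple tnth D ((p^-1)%g i) | i < N].

(* [p j] is the index [i_j] of the entry that comes [j]-th when [s] is sorted
   stably. *)
Definition stably_sorts (N a : nat) (s : N.-tuple 'I_a) (p : 'S_N) : bool :=
  [forall j : 'I_N, forall k : 'I_N, (k == j.+1 :> nat) ==>
    (tnth s (p j) <= tnth s (p k)) &&
    ((tnth s (p j) == tnth s (p k)) ==> (p j < p k))].

Section StableSort.

Variables (N a : nat) (s : N.-tuple 'I_a).

Let lexlt (i j : 'I_N) : bool :=
  (tnth s i <= tnth s j) && ((tnth s i == tnth s j) ==> (i < j)).

Let lexle (i j : 'I_N) : bool := (i == j) || lexlt i j.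

Let lexlt_trans : transitive lexlt.
Proof.
move=> j i k /andP[ij eij] /andP[jk ejk]; apply/andP; split.
  exact: leq_trans ij jk.
apply/implyP => /eqP eik.
have eq1 : tnth s i = tnth s j by apply/val_inj/eqP; rewrite eqn_leq ij eik jk.
have eq2 : tnth s j = tnth s k by rewrite -eq1 eik.
by move: eij ejk; rewrite eq1 eq2 eqxx /=; apply: ltn_trans.
Qed.

Let lexlt_irr : irreflexive lexlt.
Proof. by move=> i; rewrite /lexlt eqxx ltnn andbF. Qed.

Let lexle_total : total lexle.
Proof.
move=> i j; rewrite /lexle /lexlt -!val_eqE /=.
by case: (ltngtP (tnth s i) (tnth s j)); case: (ltngtP i j).
Qed.

Let stably_sortsE (p : 'S_N) :
  stably_sorts s p = sorted lexlt (codom p).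
Proof.
have nthE (i0 i : 'I_N) : nth i0 (codom p) i = p i.
  by rewrite (nth_map i0) ?size_enum_ord // nth_ord_enum.
apply/forallP/idP => [H | H j].
- case: (posnP N) => [N0 | N_gt0].
    by have /size0nil -> : size (codom p) = 0 by rewrite size_codom card_ord.
  apply/(sortedP (Ordinal N_gt0)) => i; rewrite size_codom card_ord => ltiN.
  have := H (Ordinal (ltnW ltiN)) => /forallP/(_ (Ordinal ltiN)).
  rewrite /= eqxx /= -(nthE (Ordinal N_gt0) (Ordinal (ltnW ltiN))).
  by rewrite -(nthE (Ordinal N_gt0) (Ordinal ltiN)).
- apply/forallP => k; apply/implyP => /eqP kE.
  have /(sortedP j)/(_ j) := H; rewrite size_codom card_ord -kE ltn_ord.
  by move=> /(_ isT); rewrite !nthE.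
Qed.

Lemma stably_sorts_exists_unique : exists! p : 'S_N, stably_sorts s p.
Proof.
pose t := sort lexle (enum 'I_N).
have szt : size t == N by rewrite size_sort size_enum_ord.
have ut : uniq t by rewrite sort_uniq enum_uniq.
have inj : injective (tnth (Tuple szt)) by apply/tuple_uniqP.
pose p := perm inj.
have pE : codom p = t.
  rewrite -[RHS]/(tval (Tuple szt)) -[in RHS](map_tnth_enum (Tuple szt)).
  by apply: eq_map => i; rewrite permE.
have sp : sorted lexlt (codom p).
  rewrite pE; case: (posnP N) => [N0 | N_gt0].
    by have /size0nil -> : size t = 0 by rewrite (eqP szt).
  have /(sortedP (Ordinal N_gt0)) st : sorted lexle t by apply: sort_sorted.
  apply/(sortedP (Ordinal N_gt0)) => i lti.
  have /orP[|//] := st i lti.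
  by rewrite nth_uniq // ?(ltnW lti) // ltn_eqF.
exists p; split=> [|q]; rewrite stably_sortsE // => sq.
have onto (u : 'S_N) i : i \in codom u.
  by apply/codomP; exists ((u^-1)%g i); rewrite permKV.
have /eq_in_map eqpq : codom p = codom q.
  by apply: (irr_sorted_eq lexlt_trans lexlt_irr) => // i; rewrite !onto.
by apply/permP => i; apply: eqpq; rewrite mem_enum.
Qed.

End StableSort.

(* Each of the [a ^ N] sequences is equally likely. *)
Definition a_shuffle (N a : nat) (p : 'S_N) : rat :=
  (#|[set s : N.-tuple 'I_a | stably_sorts s p]|%:R / (a ^ N)%:R)%R.

Definition prob_shuffle_to (T : eqType) (N a : nat) (D D' : deck T N) : rat :=
  (\sum_(p : 'S_N | apply_shuffle p D == D') a_shuffle a p)%R.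

(* Here [c] runs over 0, ..., h - 1 and the label considered is [c + 1]. *)
Definition num_unpreceded (T : eqType) (N h : nat) (D : deck T N) : nat :=
  #|[set i : 'I_N | [exists c : 'I_h, (tnth D i == inl c.+1) &&
       [forall j : 'I_N, (j < i) ==> (tnth D j != inl (val c))]]]|.

Definition num_preceding (T : eqType) (N : nat) (u v : label T) (D : deck T N) :
    nat :=
  #|[set i : 'I_N | (tnth D i == u) &&
       [exists j : 'I_N, (i < j) && (tnth D j == v)]]|.

(* Main.v *)
Require Import Defs.
From mathcomp Require Import all_boot all_order all_algebra all_fingroup.
From mathcomp Require Import zify.

(* Let q_1, ..., q_h be the positions of 1, ..., h in D. The sequence s produces
   a shuffle taking the sorted deck to D exactly when, for the order comparing
   (s_i, i) lexicographically, q_1 < ... < q_h and q_h precedes every position of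
   a card x. Equivalently s(q_c) <= s(q_{c+1}), strictly at the r - 1 descents
   q_{c+1} < q_c, and s(q_h) <= s(y) for each position y of an x, strictly for
   the l positions y < q_h. Summing over m = s(q_h), the entries at the x's can
   be chosen in (a-m-1)^l (a-m)^(n-l) ways, and the h - 1 other entries form a
   chain below m with r - 1 forced strict steps, which is counted by a binomial
   coefficient through the hockey-stick identity. *)

Set Implicit Arguments.
Unset Strict Implicit.
Unset Printing Implicit Defensive.

(** * Counting tuples and summing binomial coefficients *)

Lemma card_tuple_cons (A : finType) (k : nat) (Q : pred (k.+1.-tuple A)) :
  #|[set t | Q t]| = \sum_(v : A) #|[set t : k.-tuple A | Q [tuple of v :: t]]|.
Proof.
rewrite -sum1_card (partition_big (@thead k A) xpredT) //=.
apply: eq_bigr => v _; rewrite -sum1_card.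
rewrite (reindex (fun t : k.-tuple A => [tuple of v :: t])) /=.
  by apply: eq_bigl => t; rewrite !inE theadE eqxx andbT.
exists (fun t : k.+1.-tuple A => [tuple of behead t]) => t.
  by move=> _; apply: val_inj.
rewrite inE => /andP[_ /eqP vE]; rewrite [RHS]tuple_eta vE.
by apply: val_inj.
Qed.

Lemma card_tuple0 (A : finType) (Q : pred (0.-tuple A)) :
  #|[set t | Q t]| = Q [tuple].
Proof.
rewrite -sum1_card big_mkcond (big_pred1 [tuple]) => [|t]; last first.
  exact/esym/eqP/tuple0.
by rewrite inE; case: (Q _).
Qed.

Lemma sum_ord_geq (a b : nat) : \sum_(v < a | b <= v) 1 = a - b.
Proof.
by rewrite -(big_geq_mkord _ _ xpredT (fun=> 1)) sum_nat_const_nat muln1.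
Qed.

(** The hockey-stick identity: splitting off the term [t = b] leaves Pascal's rule. The guard is
    there because for [m < b] truncated subtraction would give ['C(k.+1, k.+1) = 1] in place of the
    empty sum. *)
Lemma sum_bin_diag (m b k : nat) :
  \sum_(b <= t < m.+1) 'C(m - t + k, k) =
  if b <= m then 'C(m - b + k.+1, k.+1) else 0.
Proof.
case: leqP => [le_bm | lt_mb]; last by rewrite big_geq.
move Dj: (m - b) => j; elim: j => [|j IHj] in b le_bm Dj *.
  have -> : b = m by lia.
  by rewrite big_nat1 subnn add0n !binn.
rewrite big_ltn; last by lia.
rewrite IHj; [| lia | lia].
by rewrite Dj !addnS !addSn binS addnC.
Qed.

(** * Counting chains with prescribed strict steps *)

(* [es] marks the strict steps of the chain starting at [b]; every remaining
   value has to be at least the end of the chain, strictly so where [fs] says. *)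
Fixpoint admissible (b : nat) (es fs : seq bool) (u : seq nat) : bool :=
  if es is e :: es' then
    if u is v :: u' then (b + e <= v) && admissible v es' fs u' else false
  else all2 (fun (f : bool) v => b + f <= v) fs u.

(** The entries are independent, with [a - b - 1] choices where [fs] is true and [a - b] elsewhere.
    The convention [0 ^ 0 = 1] is the one the theorem asks for when [l = 0] and [m = a - 1]. *)
Lemma card_admissible_nil (a b : nat) (fs : seq bool) :
  #|[set u : (size fs).-tuple 'I_a | admissible b [::] fs (map val u)]| =
  (a - b - 1) ^ count id fs * (a - b) ^ (size fs - count id fs).
Proof.
elim: fs => [|f fs IHfs] /=; first by rewrite card_tuple0.
rewrite card_tuple_cons /=.
transitivity (\sum_(v < a | b + f <= v)
  #|[set u : (size fs).-tuple 'I_a | admissible b [::] fs (map val u)]|).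
  rewrite [RHS]big_mkcond; apply: eq_bigr => v _.
  by case: leqP => // _; rewrite cards0.
rewrite sum_nat_cond_const -sum1dep_card sum_ord_geq IHfs.
have := count_size id fs; case: f => le_fs; rewrite /= ?addn0 ?add0n ?add1n.
  by rewrite subSS expnS mulnA subnDA.
by rewrite subSn // expnS mulnCA.
Qed.

(** Here [m] is the last value of the chain, which exists because of the leading mark [e]. Induction
    fixes the first value [v]; once the sums over [v] and [m] are exchanged, the choices after the
    chain depend on [m] only, and the sum over [v] is a hockey-stick sum. *)
Lemma card_admissible (a b k : nat) (e : bool) (es fs : seq bool) :
    k = size es + size fs ->
  #|[set u : k.+1.-tuple 'I_a | admissible b (e :: es) fs (map val u)]| =
  \sum_(m < a | b + count id (e :: es) <= m)
    'C(m - (b + count id (e :: es)) + size es, size es) *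
    ((a - m - 1) ^ count id fs * (a - m) ^ (size fs - count id fs)).
Proof.
elim: es => [|e' es IHes] in b k e * => kE.
all: rewrite card_tuple_cons.
  rewrite /= addn0 [RHS]big_mkcond; apply: eq_bigr => v _.
  rewrite kE add0n -card_admissible_nil bin0 mul1n.
  by case: leqP => //= _; rewrite cards0.
rewrite kE.
transitivity (\sum_(v < a | b + e <= v)
  #|[set u : (size (e' :: es) + size fs).-tuple 'I_a |
      admissible v (e' :: es) fs (map val u)]|).
  rewrite [RHS]big_mkcond; apply: eq_bigr => v _ /=.
  by case: leqP => //= _; rewrite cards0.
set c := count id (e' :: es).
under eq_bigr => v _ do rewrite (IHes v (size es + size fs)) // -/c.
rewrite (exchange_big_dep xpredT) //= [RHS]big_mkcond /=.
apply: eq_bigr => m _; rewrite -big_distrl /=.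
suff -> : \sum_(v < a | (b + e <= v) && (v + c <= m))
      'C(m - (v + c) + size es, size es) =
    if b + (e + c) <= m then 'C(m - (b + (e + c)) + (size es).+1, (size es).+1)
    else 0.
  by case: ifP.
transitivity (\sum_(b + e <= v < a | v + c <= m)
    'C(m - (v + c) + size es, size es)).
  by rewrite big_geq_mkord; apply: eq_bigl => v; rewrite andbC.
(* For [m < c] no [v] qualifies, but the truncated [m - c] would let [v = 0] through in the range
   used below. *)
have [lt_mc | le_cm] := ltnP m c.
  rewrite big_pred0; last by move=> v; lia.
  by case: leqP => //; lia.
have lt_ma := ltn_ord m.
(* Since [m < a], the condition [v + c <= m] already implies [v < a]. *)
transitivity (\sum_(b + e <= v < (m - c).+1) 'C(m - c - v + size es, size es)).
  rewrite [RHS](big_nat_widen _ _ a); last by lia.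
  by apply: eq_big => [v | v _]; [lia | congr 'C(_ + _, _); lia].
rewrite sum_bin_diag.
have -> : (b + e <= m - c) = (b + (e + c) <= m) by lia.
by congr (if _ then 'C(_ + _, _) else _); lia.
Qed.

(** * The lexicographic order behind stable sorting *)

(* The boolean [j < i] is used as the number 0 or 1, so that this is the
   lexicographic order of the pairs [(tnth s i, i)]. *)
Definition stable_le (N a : nat) (s : N.-tuple 'I_a) : rel 'I_N :=
  fun i j => tnth s i + (j < i) <= tnth s j.

Section StableOrder.

Variables (N a : nat) (s : N.-tuple 'I_a).

Lemma stable_le_trans : transitive (stable_le s).
Proof. by rewrite /stable_le => j i k; lia. Qed.

Lemma stable_le_anti : antisymmetric (stable_le s).
Proof. by rewrite /stable_le => i j ij; apply: val_inj => /=; lia. Qed.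

Lemma stable_le_total : total (stable_le s).
Proof. by rewrite /stable_le => i j; lia. Qed.

(** Consecutive entries of [codom p] are distinct, and on distinct positions the strict comparison
    in [stably_sorts] agrees with the total order [stable_le]. *)
Lemma stably_sortsE (p : 'S_N) :
  stably_sorts s p = sorted (stable_le s) (codom p).
Proof.
have leE (j k : 'I_N) : k = j.+1 :> nat ->
    (tnth s (p j) <= tnth s (p k)) &&
      ((tnth s (p j) == tnth s (p k)) ==> (p j < p k)) =
    stable_le s (p j) (p k).
  move=> kE; have : p j != p k :> nat.
    by apply/negP => /eqP/val_inj/perm_inj jk; move: kE; rewrite jk; lia.
  by rewrite /stable_le -val_eqE /=; lia.
have nthE (i0 i : 'I_N) : nth i0 (codom p) i = p i.
  by rewrite (nth_map i0) ?size_enum_ord // nth_ord_enum.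
apply/'forall_'forall_implyP/idP => [H | H j k /eqP kE].
  case: (posnP N) => [N0 | N_gt0].
    by have /size0nil -> : size (codom p) = 0 by rewrite size_codom card_ord.
  apply/(sortedP (Ordinal N_gt0)) => i; rewrite size_codom card_ord => ltiN.
  have ltiN' := ltnW ltiN.
  rewrite (nthE _ (Ordinal ltiN)) (nthE _ (Ordinal ltiN')) -leE //.
  by apply: H.
rewrite leE //; have /(sortedP j)/(_ j) := H.
by rewrite size_codom card_ord -kE ltn_ord !nthE; apply.
Qed.

End StableOrder.

(** * Which sequences produce the deck [D] *)

(** Substituting [p i] for the position cancels the inverse in [apply_shuffle]; the condition then
    bears on [codom p], which [stably_sorts] constrains as well. *)
Lemma apply_shuffle_eq (T : eqType) (N : nat) (p : 'S_N) (D0 D : deck T N) :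
  (apply_shuffle p D0 == D) = ([seq tnth D i | i <- codom p] == D0).
Proof.
have -> : [seq tnth D i | i <- codom p] = [tuple tnth D (p i) | i < N].
  by rewrite /= -map_comp.
apply/eqP/eqP => [<- | /val_inj E]; first apply: (congr1 val).
all: apply: eq_from_tnth => i.
  by rewrite !tnth_mktuple permK.
by rewrite tnth_mktuple -E tnth_mktuple permKV.
Qed.

Lemma perm_codom_enum (N : nat) (p : 'S_N) : perm_eq (codom p) (enum 'I_N).
Proof.
apply: uniq_perm; [exact/injectiveP/perm_inj | exact: enum_uniq | move=> i].
by rewrite mem_enum; apply/codomP; exists ((p^-1)%g i); rewrite permKV.
Qed.

(** Cards with unique labels force [codom p] to start with [i0 :: ps], whereas the positions [qs] of
    the cards [x] may follow in any order. *)
Lemma stably_sorts_apply (T : eqType) (N n a : nat) (x : label T)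
    (D D0 : deck T N) (i0 : 'I_N) (ps qs : seq 'I_N)
    (s : N.-tuple 'I_a) (p : 'S_N) :
    perm_eq (i0 :: ps ++ qs) (enum 'I_N) ->
    [seq tnth D i | i <- i0 :: ps ++ qs] = D0 ->
    [seq tnth D i | i <- qs] = nseq n x ->
    uniq [seq tnth D i | i <- i0 :: ps] ->
    x \notin [seq tnth D i | i <- i0 :: ps] ->
    stably_sorts s p ->
  (apply_shuffle p D0 == D) =
  path (stable_le s) i0 ps && all (stable_le s (last i0 ps)) qs.
Proof.
set R := stable_le s; set P := i0 :: ps.
rewrite -[i0 :: ps ++ qs]/(P ++ qs) => perm_Pqs D0E Dqs uP xP.
rewrite stably_sortsE apply_shuffle_eq => sp.
have perm_p : perm_eq (codom p) (P ++ qs).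
  by rewrite (perm_trans (perm_codom_enum p)) // perm_sym.
have Dq i : i \in qs -> tnth D i = x.
  move=> qi; have : tnth D i \in [seq tnth D i | i <- qs] by apply: map_f.
  by rewrite Dqs => /nseqP[].
(* A label found in [P] occurs nowhere else in [D]: [j] is not assumed to lie in [P]. *)
have injP i j : i \in P -> tnth D i = tnth D j -> i = j.
  move=> Pi Dij.
  have Pj : j \in P.
    have : j \in P ++ qs by rewrite (perm_mem perm_Pqs) mem_enum.
    rewrite mem_cat => /orP[// | /Dq Dj].
    by move: xP; rewrite -Dj -Dij map_f.
  apply/eqP; rewrite -(nth_index i0 Pi) -(nth_index i0 Pj).
  have sz k : k \in P -> index k P < size [seq tnth D i | i <- P].
    by rewrite size_map index_mem.
  have nthD k : k \in P -> nth x [seq tnth D i | i <- P] (index k P) = tnth D k.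
    by move=> Pk; rewrite (nth_map i0) ?index_mem // nth_index.
  by move/eqP: Dij; rewrite -!nthD // nth_uniq ?sz // => /eqP ->.
apply/eqP/andP => [Dp | [R_ps R_qs]].
  have tP : take (size P) (codom p) = P.
    have DtP : [seq tnth D i | i <- take (size P) (codom p)] =
        [seq tnth D i | i <- P].
      by rewrite map_take Dp -D0E map_cat take_size_cat // size_map.
    apply: (eq_from_nth (x0 := i0)) => [|k lt_k].
      by rewrite -(size_map (tnth D)) DtP size_map.
    have lt_kP : k < size P by rewrite -(size_map (tnth D)) -DtP size_map.
    apply/esym/injP; first exact: mem_nth.
    by rewrite -!(nth_map _ x) // DtP.
  move: sp perm_p; rewrite -(cat_take_drop (size P) (codom p)) tP perm_cat2l.
  move=> /= + /perm_all <-.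
  by rewrite cat_path => /andP[-> /(order_path_min (@stable_le_trans _ _ s)) ->].
(* A sorted arrangement for a total order is unique, so it suffices that [P] followed by the sorted
   [qs] is sorted. *)
have codomE : codom p = P ++ sort R qs.
  apply: (sorted_eq (@stable_le_trans _ _ s) (@stable_le_anti _ _ s)) => //.
    rewrite /P /= cat_path R_ps (path_sortedE (@stable_le_trans _ _ s)).
    rewrite all_sort R_qs.
    exact/sort_sorted/stable_le_total.
  by rewrite (perm_trans perm_p) // perm_cat2l perm_sym perm_sort.
rewrite codomE -D0E !map_cat; congr (_ ++ _).
have szqs : size qs = n by rewrite -(size_map (tnth D)) Dqs size_nseq.
rewrite Dqs; apply/eqP.
rewrite -szqs -(size_sort R) -(size_map (tnth D)) eq_sym.
apply/eqP/esym/all_pred1P; apply/allP => _ /mapP[i + ->] /=.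
by rewrite mem_sort => /Dq ->.
Qed.

(** After exchanging the sums over shuffles and sequences, each [s] contributes 0 or 1, since
    exactly one shuffle stably sorts it. *)
Lemma prob_shuffle_to_eq (T : eqType) (N n a : nat) (x : label T)
    (D D0 : deck T N) (i0 : 'I_N) (ps qs : seq 'I_N) :
    perm_eq (i0 :: ps ++ qs) (enum 'I_N) ->
    [seq tnth D i | i <- i0 :: ps ++ qs] = D0 ->
    [seq tnth D i | i <- qs] = nseq n x ->
    uniq [seq tnth D i | i <- i0 :: ps] ->
    x \notin [seq tnth D i | i <- i0 :: ps] ->
  prob_shuffle_to a D0 D =
  (#|[set s : N.-tuple 'I_a |
        path (stable_le s) i0 ps && all (stable_le s (last i0 ps)) qs]|%:R
    / (a ^ N)%:R)%R.
Proof.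
move=> H1 H2 H3 H4 H5; rewrite /prob_shuffle_to /a_shuffle -GRing.mulr_suml.
congr (_ / _)%R; rewrite -GRing.natr_sum; congr (_%:R)%R.
under eq_bigr => p _ do rewrite -sum1dep_card.
rewrite (exchange_big_dep xpredT) //= -sum1dep_card [RHS]big_mkcond.
apply: eq_bigr => s _; have [p [sp p_uniq]] := stably_sorts_exists_unique s.
rewrite -(stably_sorts_apply H1 H2 H3 H4 H5 sp).
transitivity (\sum_(q | (apply_shuffle q D0 == D) && (q == p)) 1).
  apply: eq_bigl => q; congr andb; apply/idP/eqP => [/p_uniq // | -> //].
by rewrite big_mkcondl big_pred1_eq.
Qed.

(** * From sequences of digits to chains *)

(** Whether a step of [stable_le] is strict depends on the positions alone, so the marks are the
    same for every [s]. *)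
Lemma admissible_stable_le (N a : nat) (s : N.-tuple 'I_a) (i : 'I_N)
    (ps qs : seq 'I_N) :
  admissible (tnth s i) (pairmap (fun j k : 'I_N => k < j) i ps)
    [seq (j : 'I_N) < last i ps | j <- qs]
    (map val [seq tnth s j | j <- ps ++ qs]) =
  path (stable_le s) i ps && all (stable_le s (last i ps)) qs.
Proof.
elim: ps i => [i | j ps IHps i] /=; last by rewrite IHps andbA.
by elim: qs => //= j qs ->.
Qed.

(** Reading [s] along a fixed enumeration of the positions is a bijection on tuples. Starting at 0
    with the mark [false] leaves the first value free. *)
Lemma card_stable_le (N a : nat) (i0 : 'I_N) (ps qs : seq 'I_N) :
    perm_eq (i0 :: ps ++ qs) (enum 'I_N) ->
  #|[set s : N.-tuple 'I_a |
      path (stable_le s) i0 ps && all (stable_le s (last i0 ps)) qs]| =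
  #|[set u : N.-tuple 'I_a |
      admissible 0 (false :: pairmap (fun j k : 'I_N => k < j) i0 ps)
        [seq (j : 'I_N) < last i0 ps | j <- qs] (map val u)]|.
Proof.
move=> perm_t; have szt : size (i0 :: ps ++ qs) == N.
  by rewrite (perm_size perm_t) size_enum_ord.
pose f (s : N.-tuple 'I_a) := [tuple of map (tnth s) (Tuple szt)].
have inj_f : injective f.
  move=> s s' /(congr1 val) /= /(@eq_in_map _ _ _ _ (i0 :: ps ++ qs)) eq_s.
  apply: eq_from_tnth => i; apply: eq_s.
  by rewrite (perm_mem perm_t) mem_enum.
rewrite -[RHS](on_card_preimset (f := f)); last exact/onW_bij/injF_bij.
apply: eq_card => s; rewrite !inE.
by rewrite -admissible_stable_le.
Qed.

(** * Enumerating ordinals *)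

Lemma card_set_count (N : nat) (Q : pred 'I_N) (t : seq 'I_N) :
  perm_eq t (enum 'I_N) -> #|[set i | Q i]| = count Q t.
Proof. by move=> /seq.permP ->; rewrite cardsE cardE enumT size_filter. Qed.

Lemma enum_ordD (m n : nat) :
  enum 'I_(m + n) =
  [seq lshift n i | i <- enum 'I_m] ++ [seq rshift m j | j <- enum 'I_n].
Proof.
apply: (inj_map val_inj); rewrite val_enum_ord map_cat iotaD add0n.
rewrite -(map_comp val (@lshift m n)) -(map_comp val (@rshift m n)).
congr (_ ++ _); first by rewrite -val_enum_ord; apply: eq_map.
by rewrite -[m in iota m]addn0 iotaDl -val_enum_ord -map_comp; apply: eq_map.
Qed.

(** Indexes the steps of a chain by ordinals, so that descents can be counted label by label. *)
Lemma pairmap_enum_ord (A B : Type) (k : nat) (f : A -> A -> B)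
    (g : 'I_k.+1 -> A) :
  pairmap f (g ord0) [seq g (lift ord0 i) | i <- enum 'I_k] =
  [seq f (g (widen_ord (leqnSn k) i)) (g (lift ord0 i)) | i <- enum 'I_k].
Proof.
elim: k => [|k IHk] in g *; first by rewrite enum_ord0.
rewrite enum_ordSl /= -!(map_comp _ (lift ord0)).
rewrite (IHk (g \o lift ord0)) /=; congr (f (g _) _ :: _).
  exact: val_inj.
by apply: eq_map => i /=; congr (f (g _) _); apply: val_inj.
Qed.

(** * Positions of the cards, and [r] and [l] as numbers of strict marks *)

Theorem theorem2p2 (T : eqType) (h n a : nat) (hh : 1 <= h) (hn : 1 <= n)
    (ha : 1 <= a) (x : label T) (hx : forall c : nat, c <= h -> x <> inl c)
    (D : deck T (h + n)) (hD : perm_eq D (sorted_deck h n x)) :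
  let r := num_unpreceded h D in
  let l := num_preceding x (inl h) D in
  prob_shuffle_to a (sorted_deck h n x) D =
  (1 / (a ^ (n + h))%:R *
   \sum_(r - 1 <= m < a)
     ('C(m + h - r, h - 1) * (a - m - 1) ^ l * (a - m) ^ (n - l))%:R)%R.
Proof.
case: h hh hx D hD => [//|h] _ hx D hD r l.
(* [p0] sends each place of the sorted deck to a position of [D] with the same label; any choice
   among the cards [x] will do. *)
have [p0 D0E] : exists p0 : 'S_(h.+1 + n),
    sorted_deck h.+1 n x = [tuple tnth D (p0 i) | i < h.+1 + n].
  move: hD; rewrite perm_sym => /tuple_permP[p0 E].
  by exists p0; apply: val_inj.
have D0nth (i : 'I_(h.+1 + n)) : tnth D (p0 i) = tnth (sorted_deck h.+1 n x) i.
  by rewrite D0E tnth_mktuple.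
have Dl (c : 'I_h.+1) : tnth D (p0 (lshift n c)) = inl c.+1.
  rewrite D0nth (tnth_nth x) nth_cat size_map size_iota (ltn_ord c).
  by rewrite (nth_map 0) ?size_iota ?(ltn_ord c) // nth_iota ?(ltn_ord c).
have Dr (j : 'I_n) : tnth D (p0 (rshift h.+1 j)) = x.
  rewrite D0nth (tnth_nth x) nth_cat size_map size_iota ltnNge leq_addr /=.
  by rewrite addKn nth_nseq ltn_ord.
(* By [Dl], [g c] is the position in [D] of the card labeled [c.+1]. *)
pose g c := p0 (lshift n c).
pose i0 := g ord0; pose ps := [seq g (lift ord0 c) | c <- enum 'I_h].
pose qs := [seq p0 (rshift h.+1 j) | j <- enum 'I_n].
have Pg : i0 :: ps = [seq g c | c <- enum 'I_h.+1].
  by rewrite enum_ordSl /= -(map_comp g).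
have lastE : last i0 ps = g ord_max.
  by rewrite -[LHS]/(last i0 (i0 :: ps)) Pg enum_ordSr map_rcons last_rcons.
have tE : i0 :: ps ++ qs = codom p0.
  rewrite -cat_cons Pg codomE enum_ordD map_cat.
  by rewrite -(map_comp p0 (@lshift _ n)) -(map_comp p0 (@rshift h.+1 n)).
have perm_t : perm_eq (i0 :: ps ++ qs) (enum 'I_(h.+1 + n)).
  by rewrite tE perm_codom_enum.
have DP : [seq tnth D i | i <- i0 :: ps] = [seq inl c.+1 | c : 'I_h.+1].
  by rewrite Pg -(map_comp _ g); apply: eq_map => c /=; apply: Dl.
have xP : x \notin [seq tnth D i | i <- i0 :: ps].
  by rewrite DP; apply/mapP => -[c _]; apply: hx.
have szps : size ps = h by rewrite size_map size_enum_ord.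
have szqs : size qs = n by rewrite size_map size_enum_ord.
have neq_x c : c <= h.+1 -> (x == inl c) = false.
  by move=> le_c; apply/eqP; apply: hx.
have Dx : {in i0 :: ps, forall i, (tnth D i == x) = false}.
  by move=> i Pi; apply: contraNF xP => /eqP <-; apply: map_f.
have Dqs : {in qs, forall i, tnth D i = x} by move=> _ /mapP[j _ ->].
have memP i : (i \in i0 :: ps) || (i \in qs).
  by rewrite -mem_cat (perm_mem perm_t) mem_enum.
have DinlE i (c : 'I_h.+1) : (tnth D i == inl c.+1) = (i == g c).
  have /orP[] := memP i => [| qs_i].
    rewrite Pg => /mapP[c' _ ->]; rewrite Dl.
    by rewrite (inj_eq perm_inj) (inj_eq (@lshift_inj _ _)).
  rewrite (Dqs _ qs_i) neq_x ?(ltn_ord c) //; apply/esym/negbTE/eqP => igc.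
  by move: (Dl c); rewrite -[p0 _]igc (Dqs _ qs_i); apply/hx/ltn_ord.
(* Card 1 always counts, as no card is labeled 0 ([neq_x] covers [c = 0]). Any other numbered card
   counts exactly when it lies above its predecessor, which is a descent and hence a strict mark. *)
have rE : r = (count id (pairmap (fun j k : 'I_(h.+1 + n) => k < j) i0 ps)).+1.
  (* The position [g c] determines its label, so the existential collapses to [c' = c]. *)
  have QE (c : 'I_h.+1) :
      [exists c' : 'I_h.+1, (tnth D (g c) == inl c'.+1) &&
         [forall j : 'I_(h.+1 + n), (j < g c) ==> (tnth D j != inl (val c'))]] =
      [forall j : 'I_(h.+1 + n), (j < g c) ==> (tnth D j != inl (val c))].
    apply/existsP/idP => [[c' /andP[+ Hc']] | Hc]; last first.
      by exists c; rewrite Dl eqxx.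
    rewrite DinlE => /eqP/perm_inj/lshift_inj cc'.
    by rewrite {2}cc'.
  rewrite /r /num_unpreceded (card_set_count _ perm_t) /= count_cat.
  rewrite QE -[RHS]add1n -[X in 1 + X]addn0; congr (_ + (_ + _)).
  - apply/eqP; rewrite eqb1; apply/forallP => j; apply/implyP => _.
    have /orP[] := memP j => [| /Dqs ->]; last by rewrite neq_x.
    by rewrite Pg => /mapP[c' _ ->]; rewrite Dl.
  - rewrite pairmap_enum_ord !count_map; apply: eq_count => c /=.
    have DinlS j : (tnth D j == inl (val (lift ord0 c))) =
        (j == g (widen_ord (leqnSn h) c)).
      exact: (DinlE j (widen_ord (leqnSn h) c)).
    rewrite QE; apply/forallP/idP => [Hc | lt_c j].
      have := Hc (g (widen_ord (leqnSn h) c)).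
      rewrite DinlS eqxx implybF -leqNgt leq_eqVlt => /orP[/eqP/val_inj|//].
      by move=> /perm_inj/lshift_inj/(congr1 val) /=; rewrite /bump; lia.
    rewrite DinlS; apply/implyP => lt_j.
    by apply: contraTneq lt_j => ->; rewrite -leqNgt ltnW.
  - apply/eqP; rewrite eqn0Ngt -has_count; apply/hasPn => i qs_i.
    by rewrite negb_exists; apply/forallP => c; rewrite (Dqs _ qs_i) neq_x //.
have lE : l = count id [seq (j : 'I_(h.+1 + n)) < last i0 ps | j <- qs].
  rewrite /l /num_preceding (card_set_count _ perm_t) -cat_cons count_cat.
  rewrite -[RHS]add0n lastE count_map; congr (_ + _).
    apply/eqP; rewrite eqn0Ngt -has_count; apply/hasPn => i Pi.
    by rewrite (Dx _ Pi).
  apply: eq_in_count => i qs_i /=; rewrite (Dqs _ qs_i) eqxx /=.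
  apply/existsP/idP => [[j /andP[lt_ij]] | lt_i].
    by rewrite (DinlE j ord_max) => /eqP <-.
  by exists (g ord_max); rewrite lt_i Dl eqxx.
rewrite (prob_shuffle_to_eq a (n := n) perm_t _ _ _ xP).
- rewrite card_stable_le // (card_admissible _ _ (k := h + n)); last first.
    by rewrite size_pairmap size_map szps szqs.
  rewrite GRing.mul1r GRing.mulrC (addnC n); congr (_ * _)%R.
  rewrite -GRing.natr_sum; congr (_%:R)%R.
  rewrite /= !add0n -lE rE subn1 /= big_geq_mkord.
  apply: eq_bigr => m le_m; rewrite mulnA size_pairmap size_map szps szqs.
  (* The bound [r - 1 <= m] keeps the truncated subtraction in ['C] exact, so that both upper
     arguments agree. *)
  by congr ('C(_, _) * _ * _); lia.
- by rewrite tE D0E -map_comp.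
- apply/eqP; rewrite -[in nseq n]szqs -(size_map (tnth D)).
  by apply/eqP/all_pred1P/allP => _ /mapP[i /Dqs -> ->] /=.
- by rewrite DP map_inj_uniq ?enum_uniq // => c d [] /val_inj.
Qed.
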